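(* Let $\kappa\in\mathbb{R}$, $\tau\ge0$, $\kappa\neq4\tau^2$, and $a\in\mathbb{R}$. The profile curve of a screw motion tube in $\mathbb{E}(\kappa,\tau)$ with pitch $a$ has dihedral symmetry of order $4$ (that is, the curve is invariant under reflection at two orthogonal lines) if and only if $2\tau^2-a\tau\kappa=0$. If $2\tau^2-a\tau\kappa\neq0$, the profile curve only has dihedral symmetry of order $2$.
   Context: Ambient space. Let $\mathrm{sn}_\kappa(r)=\frac{1}{\sqrt\kappa}\sin(\sqrt\kappa r),\ r,\ \frac{1}{\sqrt{-\kappa}}\sinh(\sqrt{-\kappa}r)$ and $\mathrm{cs}_\kappa(r)=\cos(\sqrt\kappa r),\ 1,\ \cosh(\sqrt{-\kappa}r)$ for $\kappa>0$, $\kappa=0$, $\kappa<0$ respectively. $\mathbb{E}(\kappa,\tau)$ is the homogeneous 3-manifold fibering over the simply connected surface of curvature $\kappa$ with geodesic fibers and bundle curvature $\tau$; it is modelled (up to a fiberwise covering and removal of the fiber(s) over $r=0$ and, if $\kappa>0$, $r=\pi/\sqrt\kappa$) by $(r,\theta,z)\in I_\kappa\times[0,2\pi)\times\mathbb{R}$, $\theta$ taken modulo $2\pi$, with $I_\kappa=(0,\infty)$ if $\kappa\le0$ and $(0,\pi/\sqrt\kappa)$ if $\kappa>0$, and metric $dr^2+\mathrm{sn}_\kappa^2(r)d\theta^2+(4\tau\,\mathrm{sn}_\kappa^2(\frac r2)d\theta-dz)^2$. The screw motion group of pitch $a$ is $G_a=\{(r,\theta,z)\mapsto(r,\theta+s,z+as):s\in\mathbb{R}\}$;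 $(r,h)\in I_\kappa\times\mathbb{R}$ are coordinates on the orbit space. Tubes. Let $\Xi=\{(H,J):H>0,\ J\in(-\frac{4H}{\kappa},0)\}$ if $\kappa>0$ and $\Xi=\{(H,J):H>\frac{\sqrt{-\kappa}}2,\ J<0\}$ if $\kappa\le0$. For $(H,J)\in\Xi$ and $\sigma\in\mathbb{R}$ let $r(\sigma)\in I_\kappa$ be the unique solution of $\frac{2H}{\kappa}(\mathrm{cs}_\kappa(r)-1)+\mathrm{sn}_\kappa(r)\sin\sigma=J$ (for $\kappa=0$: $-Hr^2+r\sin\sigma=J$) and $$h_a(\sigma)=\int_{\pi/2}^\sigma\frac{dh}{d\sigma}\,d\sigma,\qquad \frac{dh}{d\sigma}=\frac{\sqrt{\mathrm{sn}_\kappa^2(r)+(4\tau\,\mathrm{sn}_\kappa^2(\frac r2)-a)^2}}{2H\,\mathrm{sn}_\kappa(r)-\mathrm{cs}_\kappa(r)\sin\sigma}\sin\sigma .$$ The profile curve is $\sigma\mapsto(r(\sigma),h_a(\sigma))$; it generates the $G_a$-invariant surface $\Sigma_a(H,J)=\{(r(\sigma),s,h_a(\sigma)+as)\}$ of constant mean curvature $H$. $\Sigma_a(H,J)$ is a screw motion tube if its profile curve is a simple closed curve, equivalently $\int_{\pi/2}^{3\pi/2}\frac{dh}{d\sigma}d\sigma=0$. Symmetry. Reflections are taken in the $(r,h)$ coordinates of the orbit space, at lines $\{h=\text{const}\}$ and $\{r=\text{const}\}$. Dihedral symmetry of order $4$ means invariance under reflection at a line $\{h=h_0\}$ and at a line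 $\{r=r_0\}$; only dihedral symmetry of order $2$ means invariance under reflection at a line $\{h=h_0\}$ but at no line $\{r=r_0\}$. *)

(* Defs.v *)
From Stdlib Require Import Reals.
From Coquelicot Require Import Coquelicot.
Open Scope R_scope.

Definition sn (kappa r : R) : R :=
  if Rlt_dec 0 kappa then sin (sqrt kappa * r) / sqrt kappa
  else if Rlt_dec kappa 0 then sinh (sqrt (- kappa) * r) / sqrt (- kappa)
  else r.

Definition cs (kappa r : R) : R :=
  if Rlt_dec 0 kappa then cos (sqrt kappa * r)
  else if Rlt_dec kappa 0 then cosh (sqrt (- kappa) * r)
  else 1.

(* The interval I_kappa of admissible radii: the orbit space of the screw
   motion group is I_kappa x R, with coordinates (r, h). *)
Definition in_I (kappa r : R) : Prop :=
  0 < r /\ (0 < kappa -> r < PI / sqrt kappa).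

(* The parameter domain Xi of the family Sigma_a(H, J). *)
Definition in_Xi (kappa H J : R) : Prop :=
  (0 < kappa -> 0 < H /\ - (4 * H / kappa) < J < 0) /\
  (kappa <= 0 -> sqrt (- kappa) / 2 < H /\ J < 0).

(* The first integral whose level set {= J} is the curve; its value for
   kappa = 0 is the limit of the other branch. *)
Definition first_integral (kappa H sigma r : R) : R :=
  if Req_EM_T kappa 0 then - H * r ^ 2 + r * sin sigma
  else 2 * H / kappa * (cs kappa r - 1) + sn kappa r * sin sigma.

(* Coquelicot's [iota] is a definite description: [iota_correct] applies
   once existence and uniqueness of the solution are known, which is the case
   for (H, J) in Xi. *)
Definition radius (kappa H J sigma : R) : R :=
  iota (fun r : R => in_I kappa r /\ first_integral kappa H sigma r = J).

Definition dheight (kappa tau a H J sigma : R) : R :=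
  let r := radius kappa H J sigma in
  sqrt (sn kappa r ^ 2 + (4 * tau * sn kappa (r / 2) ^ 2 - a) ^ 2)
    / (2 * H * sn kappa r - cs kappa r * sin sigma) * sin sigma.

Definition height (kappa tau a H J sigma : R) : R :=
  RInt (dheight kappa tau a H J) (PI / 2) sigma.

(* The profile curve, in the coordinates (r, h) of the orbit space, of the
   surface Sigma_a(H, J) in E(kappa, tau). *)
Definition profile (kappa tau a H J sigma : R) : R * R :=
  (radius kappa H J sigma, height kappa tau a H J sigma).

Definition simple_closed (gamma : R -> R * R) : Prop :=
  (forall s, continuous gamma s) /\
  exists P : R, 0 < P /\
    (forall s, gamma (s + P) = gamma s) /\
    (forall s t, 0 <= s < P -> 0 <= t < P -> gamma s = gamma t -> s = t).

(* Sigma_a(H, J) is a screw motion tube of pitch a. *)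
Definition screw_motion_tube (kappa tau a H J : R) : Prop :=
  in_Xi kappa H J /\ simple_closed (profile kappa tau a H J).

Definition trace (gamma : R -> R * R) (p : R * R) : Prop :=
  exists s, gamma s = p.

Definition reflect_h (h0 : R) (p : R * R) : R * R := (fst p, 2 * h0 - snd p).
Definition reflect_r (r0 : R) (p : R * R) : R * R := (2 * r0 - fst p, snd p).

Definition invariant (f : R * R -> R * R) (A : R * R -> Prop) : Prop :=
  forall p, A (f p) <-> A p.

(* A line {r = r0} of the orbit space has r0 in I_kappa. *)
Definition symmetric_h (A : R * R -> Prop) : Prop :=
  exists h0, invariant (reflect_h h0) A.
Definition symmetric_r (kappa : R) (A : R * R -> Prop) : Prop :=
  exists r0, in_I kappa r0 /\ invariant (reflect_r r0) A.

Definition dihedral_order4 (kappa : R) (A : R * R -> Prop) : Prop :=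
  symmetric_h A /\ symmetric_r kappa A.
Definition only_dihedral_order2 (kappa : R) (A : R * R -> Prop) : Prop :=
  symmetric_h A /\ ~ symmetric_r kappa A.

(* Main.v *)
Require Import Defs.
From Stdlib Require Import Reals ZArith Lra Lia.
From Coquelicot Require Import Coquelicot.
Open Scope R_scope.

(* Put v = sin sigma and T = sn(r/2)/cs(r/2). The first integral becomes
   A T^2 - 2 v T + J = 0 with A = 4H + kappa J > 0, whose only positive root is
   T(v) = (v + sqrt(v^2 - J A)) / A, and T(v) T(-v) = -J/A. The integrand is then
   dh = Q(v) v / sqrt(v^2 - J A), where with x = sn(r/2)^2
     Q(v)^2 - Q(-v)^2
       = (x(v) - x(-v)) (4 - 8 a tau + (16 tau^2 - 4 kappa) (x(v) + x(-v))),
   and x is increasing. If the last factor keeps a constant nonzero sign, folding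
   the closing integral at sigma = 0 shows that it does not vanish.
   The sign of 1 - kappa (x(v) + x(-v)) is that of 4H + 2 kappa J. Hence a tube with
   2 tau^2 = a tau kappa has 4H + 2 kappa J = 0, i.e. it is centred at the equator,
   where sigma -> -sigma is the reflection r -> PI/sqrt kappa - r and Q is even.
   Conversely a reflection in r must swap the extremal radii and fix the point of
   maximal height (at sigma = PI); this forces 4H + 2 kappa J = 0, so
   x(v) + x(-v) = 1/kappa and closing gives 2 tau^2 = a tau kappa. *)

(** * Generalized trigonometry of [sn] and [cs] *)

Lemma cs2_sn2 (k x : R) : cs k x ^ 2 + k * sn k x ^ 2 = 1.
Proof.
unfold cs, sn.
destruct (Rlt_dec 0 k) as [hk|hk]; [|destruct (Rlt_dec k 0) as [hk'|hk']].
- pose proof (sqrt_lt_R0 k hk) as hq; pose proof (sqrt_sqrt k (Rlt_le _ _ hk)) as e.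
  set (q := sqrt k) in *; rewrite <- e.
  pose proof (sin2_cos2 (q * x)) as e2; unfold Rsqr in e2.
  rewrite <- e2; field; lra.
- assert (h0 : 0 < - k) by lra.
  pose proof (sqrt_lt_R0 _ h0) as hq; pose proof (sqrt_sqrt _ (Rlt_le _ _ h0)) as e.
  set (q := sqrt (- k)) in *; replace k with (- (q * q)) by lra.
  pose proof (exp_pos (q * x)).
  unfold cosh, sinh; rewrite exp_Ropp; field; lra.
- replace k with 0 by lra; ring.
Qed.

(** Only the difference laws are proved by cases on the sign of [k]; the values at 0 and the sum
    laws then follow algebraically. *)
Lemma sn_minus (k x y : R) : sn k (x - y) = sn k x * cs k y - cs k x * sn k y.
Proof.
unfold cs, sn.
destruct (Rlt_dec 0 k) as [hk|hk]; [|destruct (Rlt_dec k 0) as [hk'|hk']].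
- pose proof (sqrt_lt_R0 k hk) as hq.
  rewrite Rmult_minus_distr_l, sin_minus; field; lra.
- pose proof (sqrt_lt_R0 (- k) ltac:(lra)) as hq.
  set (q := sqrt (- k)) in *.
  pose proof (exp_pos (q * x)); pose proof (exp_pos (q * y)).
  unfold cosh, sinh; replace (q * (x - y)) with (q * x + - (q * y)) by ring.
  rewrite !exp_Ropp, exp_plus, exp_Ropp; field; lra.
- ring.
Qed.

Lemma cs_minus (k x y : R) : cs k (x - y) = cs k x * cs k y + k * (sn k x * sn k y).
Proof.
unfold cs, sn.
destruct (Rlt_dec 0 k) as [hk|hk]; [|destruct (Rlt_dec k 0) as [hk'|hk']].
- pose proof (sqrt_lt_R0 k hk) as hq; pose proof (sqrt_sqrt k (Rlt_le _ _ hk)) as e.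
  set (q := sqrt k) in *; rewrite <- e.
  rewrite Rmult_minus_distr_l, cos_minus; field; lra.
- assert (h0 : 0 < - k) by lra.
  pose proof (sqrt_lt_R0 _ h0) as hq; pose proof (sqrt_sqrt _ (Rlt_le _ _ h0)) as e.
  set (q := sqrt (- k)) in *; replace k with (- (q * q)) by lra.
  pose proof (exp_pos (q * x)); pose proof (exp_pos (q * y)).
  unfold cosh, sinh; replace (q * (x - y)) with (q * x + - (q * y)) by ring.
  rewrite !exp_Ropp, exp_plus, exp_Ropp; field; lra.
- replace k with 0 by lra; ring.
Qed.

Lemma sn_0 (k : R) : sn k 0 = 0.
Proof. pose proof (sn_minus k 0 0) as e; rewrite Rminus_0_r in e; lra. Qed.

(** [cs_minus] at (0, 0) says that cs 0 equals its own square, and [cs2_sn2] says that this square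
    is 1. *)
Lemma cs_0 (k : R) : cs k 0 = 1.
Proof.
pose proof (cs_minus k 0 0) as e; pose proof (sn_minus k 1 0) as e1.
pose proof (cs2_sn2 k 0) as e2; rewrite Rminus_0_r, sn_0 in *.
nra.
Qed.

Lemma sn_plus (k x y : R) : sn k (x + y) = sn k x * cs k y + cs k x * sn k y.
Proof.
replace (x + y) with (x - (0 - y)) by ring.
rewrite sn_minus, (sn_minus k 0 y), (cs_minus k 0 y), sn_0, cs_0; ring.
Qed.

Lemma cs_plus (k x y : R) : cs k (x + y) = cs k x * cs k y - k * (sn k x * sn k y).
Proof.
replace (x + y) with (x - (0 - y)) by ring.
rewrite cs_minus, (sn_minus k 0 y), (cs_minus k 0 y), sn_0, cs_0; ring.
Qed.

Lemma sn_pos (k x : R) : in_I k x -> 0 < sn k x.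
Proof.
intros [h0 h1]; unfold sn.
destruct (Rlt_dec 0 k) as [hk|hk]; [|destruct (Rlt_dec k 0) as [hk'|hk']]; auto.
- pose proof (sqrt_lt_R0 k hk) as hq; specialize (h1 hk).
  apply Rdiv_lt_0_compat; auto; apply sin_gt_0; [nra|].
  apply Rlt_div_r in h1; lra.
- pose proof (sqrt_lt_R0 (- k) ltac:(lra)) as hq.
  apply Rdiv_lt_0_compat; auto.
  rewrite <- sinh_0; apply sinh_lt; nra.
Qed.

Lemma cs_half_pos (k x : R) : in_I k x -> 0 < cs k (x / 2).
Proof.
intros [h0 h1]; unfold cs.
destruct (Rlt_dec 0 k) as [hk|hk]; [|destruct (Rlt_dec k 0) as [hk'|hk']].
- pose proof (sqrt_lt_R0 k hk) as hq; specialize (h1 hk).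
  apply Rlt_div_r in h1; auto.
  pose proof PI_RGT_0; apply cos_gt_0; nra.
- unfold cosh; pose proof (exp_pos (sqrt (- k) * (x / 2))).
  pose proof (exp_pos (- (sqrt (- k) * (x / 2)))); lra.
- lra.
Qed.

Lemma in_I_lt (k x y : R) : in_I k x -> 0 < y < x -> in_I k y.
Proof. intros [h0 h1] h; split; [lra|intros hk; specialize (h1 hk); lra]. Qed.

(** Inverts the half-angle tangent sn(r/2)/cs(r/2). For k < 0 the second hypothesis places sqrt(-k)
    t below 1, in the range of tanh. *)
Lemma ex_half_angle (k t : R) : 0 < t -> 0 < 1 + k * t ^ 2 ->
  exists r, in_I k r /\ sn k (r / 2) = t * cs k (r / 2).
Proof.
intros ht hkt; unfold in_I, sn, cs.
destruct (Rlt_dec 0 k) as [hk|hk]; [|destruct (Rlt_dec k 0) as [hk'|hk']].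
- pose proof (sqrt_lt_R0 k hk) as hq; set (q := sqrt k) in *.
  pose proof (atan_bound (q * t)) as hb.
  assert (0 < atan (q * t)) by (rewrite <- atan_0; apply atan_increasing; nra).
  (* Solves tan(q r / 2) = q t. *)
  exists (2 * atan (q * t) / q); split; [split|].
  + apply Rdiv_lt_0_compat; lra.
  + intros _; apply Rmult_lt_compat_r; [apply Rinv_0_lt_compat|]; lra.
  + replace (q * (2 * atan (q * t) / q / 2)) with (atan (q * t)) by (field; lra).
    pose proof (tan_atan (q * t)) as e; unfold tan in e.
    assert (0 < cos (atan (q * t))) by (apply cos_gt_0; lra).
    apply (f_equal (fun z => z * cos (atan (q * t)) / q)) in e.
    field_simplify in e; lra.
- assert (h0 : 0 < - k) by lra.
  pose proof (sqrt_lt_R0 _ h0) as hq; pose proof (sqrt_sqrt _ (Rlt_le _ _ h0)) as e.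
  set (q := sqrt (- k)) in *; assert (0 < q * t) by nra.
  assert (q * t < 1).
  { assert (q * t * (q * t) < 1) by (replace (q * t * (q * t)) with (q * q * t ^ 2) by ring; rewrite e; lra).
    nra. }
  (* Here r = 2 artanh(q t) / q, with artanh written as half the logarithm of [w]. *)
  assert (hw : 0 < (1 + q * t) / (1 - q * t)) by (apply Rdiv_lt_0_compat; lra).
  set (w := (1 + q * t) / (1 - q * t)) in *.
  assert (1 < w) by (unfold w; apply Rlt_div_r; lra).
  exists (ln w / q); split; [split|].
  + apply Rdiv_lt_0_compat; auto; rewrite <- ln_1; apply ln_increasing; lra.
  + intros; lra.
  + replace (q * (ln w / q / 2)) with (ln w / 2) by (field; lra).
    unfold sinh, cosh; rewrite exp_Ropp.
    assert (e2 : exp (ln w / 2) * exp (ln w / 2) = w).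
    { rewrite <- exp_plus, <- (exp_ln w hw); f_equal; rewrite (exp_ln w hw); field. }
    pose proof (exp_pos (ln w / 2)) as he; set (z := exp (ln w / 2)) in *.
    assert (e3 : z * z * (1 - q * t) = 1 + q * t)
      by (rewrite e2; unfold w; field; nra).
    apply (Rmult_eq_reg_r (2 * q * z)); [|nra].
    field_simplify; [|lra|lra]; nra.
- exists (2 * t); split; [split|]; lra.
Qed.

(** Since cs r - 1 = -2k sn(r/2)^2, the division by k cancels and both branches of the definition
    take one form. *)
Lemma first_integral_half (k H s r : R) :
  first_integral k H s r
  = - 4 * H * sn k (r / 2) ^ 2 + 2 * sn k (r / 2) * cs k (r / 2) * sin s.
Proof.
unfold first_integral; destruct (Req_EM_T k 0) as [->|hk].
- unfold sn, cs; destruct (Rlt_dec 0 0); [lra|]; field.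
- replace (cs k r) with (1 - 2 * k * sn k (r / 2) ^ 2).
  + replace (sn k r) with (2 * sn k (r / 2) * cs k (r / 2)); [field; auto|].
    replace r with (r / 2 + r / 2) at 3 by field; rewrite sn_plus; ring.
  + replace r with (r / 2 + r / 2) at 2 by field; rewrite cs_plus.
    pose proof (cs2_sn2 k (r / 2)); nra.
Qed.

(** * Integrals of continuous functions under shift, reflection and period *)

Lemma ex_RInt_cont (f : R -> R) (a b : R) :
  (forall x, continuous f x) -> ex_RInt f a b.
Proof. intros hf; apply (ex_RInt_continuous (V := R_CompleteNormedModule)); auto. Qed.

Lemma RInt_split (f : R -> R) (a b c : R) :
  (forall x, continuous f x) -> RInt f a c = RInt f a b + RInt f b c.
Proof.
intros hf; symmetry; apply (RInt_Chasles (V := R_CompleteNormedModule));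
  apply ex_RInt_cont; auto.
Qed.

Lemma RInt_same (f : R -> R) (a : R) : RInt f a a = 0.
Proof. apply (RInt_point (V := R_CompleteNormedModule)). Qed.

Lemma RInt_shift (f : R -> R) (a b c : R) :
  (forall x, continuous f x) -> RInt f (a + c) (b + c) = RInt (fun x => f (x + c)) a b.
Proof.
intros hf.
pose proof (RInt_comp_lin (V := R_CompleteNormedModule) f 1 c a b
  (ex_RInt_cont _ _ _ hf)) as e.
rewrite !Rmult_1_l in e; rewrite <- e; apply RInt_ext; intros x _.
unfold scal; simpl; unfold mult; simpl; rewrite !Rmult_1_l; reflexivity.
Qed.

Lemma RInt_reflect (f : R -> R) (a b c : R) :
  (forall x, continuous f x) -> RInt f (c - b) (c - a) = RInt (fun x => f (c - x)) a b.
Proof.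
intros hf.
pose proof (RInt_comp_lin (V := R_CompleteNormedModule) f (-1) c a b
  (ex_RInt_cont _ _ _ hf)) as e.
replace (-1 * a + c) with (c - a) in e by ring.
replace (-1 * b + c) with (c - b) in e by ring.
pose proof (RInt_split f (c - b) (c - a) (c - b) hf) as e1; rewrite RInt_same in e1.
replace (RInt f (c - b) (c - a)) with (- RInt f (c - a) (c - b)) by lra.
rewrite <- e.
transitivity (RInt (fun y => opp (scal (-1) (f (-1 * y + c)))) a b).
- symmetry; apply (RInt_opp (V := R_CompleteNormedModule)).
  apply (ex_RInt_comp_lin (V := R_NormedModule)); apply ex_RInt_cont; auto.
- apply RInt_ext; intros x _; unfold opp, scal; simpl; unfold mult; simpl.
  replace (-1 * x + c) with (c - x) by ring; ring.
Qed.

Lemma continuous_minus_arg (f : R -> R) (c : R) :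
  (forall x, continuous f x) -> forall x, continuous (fun y => f (c - y)) x.
Proof.
intros hf x; apply (continuous_comp (fun y => c - y) f); auto.
apply (ex_derive_continuous (V := R_NormedModule)); auto_derive; auto.
Qed.

Lemma RInt_odd (f : R -> R) (s : R) :
  (forall x, continuous f x) -> (forall x, f (- x) = - f x) -> RInt f (- s) s = 0.
Proof.
intros hf ho.
pose proof (RInt_reflect f (- s) s 0 hf) as e.
replace (0 - s) with (- s) in e by ring; replace (0 - - s) with s in e by ring.
enough (RInt (fun x => f (0 - x)) (- s) s = - RInt f (- s) s) by lra.
transitivity (RInt (fun x => opp (f x)) (- s) s).
- apply RInt_ext; intros x _; rewrite Rminus_0_l; apply ho.
- apply (RInt_opp (V := R_CompleteNormedModule)), ex_RInt_cont, hf.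
Qed.

Lemma RInt_fold (f : R -> R) (s : R) :
  (forall x, continuous f x) -> RInt f (- s) s = RInt (fun x => f x + f (- x)) 0 s.
Proof.
intros hf; rewrite (RInt_split f (- s) 0 s hf).
pose proof (RInt_reflect f 0 s 0 hf) as e.
replace (0 - s) with (- s) in e by ring; rewrite Rminus_0_r in e; rewrite e.
rewrite Rplus_comm; symmetry.
transitivity (RInt (fun x => plus (f x) (f (0 - x))) 0 s).
- apply RInt_ext; intros x _; rewrite Rminus_0_l; reflexivity.
- apply (RInt_plus (V := R_CompleteNormedModule)); apply ex_RInt_cont; auto.
  apply continuous_minus_arg, hf.
Qed.

(** Fold at 0 and integrate a function of constant sign. The factor [c] lets one statement cover
    both signs. *)
Lemma RInt_sym_neq0 (f : R -> R) (c s : R) :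
  (forall x, continuous f x) -> 0 < s ->
  (forall x, 0 < x < s -> 0 < c * (f x + f (- x))) -> RInt f (- s) s <> 0.
Proof.
intros hf hs hpos h0; rewrite (RInt_fold f s hf) in h0.
assert (hc : forall x, continuous (fun x => f x + f (- x)) x).
{ intros x; apply (continuous_plus (V := R_NormedModule)); auto.
  apply (continuous_ext (fun y : R => f (0 - y))); [intros y; unfold Rminus; rewrite Rplus_0_l; reflexivity|].
  apply continuous_minus_arg, hf. }
enough (0 < RInt (fun x => c * (f x + f (- x))) 0 s) as h.
{ rewrite (RInt_scal (V := R_CompleteNormedModule) (fun x => f x + f (- x))) in h
    by (apply ex_RInt_cont; auto).
  rewrite h0 in h; unfold scal in h; simpl in h; unfold mult in h; simpl in h; lra. }
apply RInt_gt_0; auto; intros x _.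
apply (continuous_scal_r (V := R_NormedModule)); auto.
Qed.

Lemma RInt_period (f : R -> R) (p s : R) :
  (forall x, continuous f x) -> (forall x, f (x + 2 * p) = f x) ->
  RInt f s (s + 2 * p) = RInt f (- p) p.
Proof.
intros hf hp.
rewrite (RInt_split f s p (s + 2 * p) hf), (RInt_split f (- p) s p hf).
pose proof (RInt_shift f (- p) s (2 * p) hf) as e.
replace (- p + 2 * p) with p in e by ring; rewrite e.
rewrite (RInt_ext (V := R_CompleteNormedModule) (fun x => f (x + 2 * p)) f) by auto.
apply Rplus_comm.
Qed.

Lemma RInt_nperiod (f : R -> R) (p s : R) (n : nat) :
  (forall x, continuous f x) -> (forall x, f (x + 2 * p) = f x) ->
  RInt f s (s + 2 * INR n * p) = INR n * RInt f (- p) p.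
Proof.
intros hf hp; induction n as [|n IH].
- simpl; replace (s + 2 * 0 * p) with s by ring; rewrite RInt_same; ring.
- rewrite (RInt_split f s (s + 2 * INR n * p)), IH, S_INR by auto.
  replace (s + 2 * (INR n + 1) * p) with (s + 2 * INR n * p + 2 * p) by ring.
  rewrite RInt_period by auto.
  match goal with |- ?a = ?b => change (@eq R a b) end; ring.
Qed.

(** From cos p = 1 - 2 sin(p/2)^2, p/2 is a zero of the sine. *)
Lemma cos_eq_1_period (p : R) : 0 < p -> cos p = 1 ->
  exists n : nat, (0 < n)%nat /\ p = 2 * INR n * PI.
Proof.
intros hp e.
assert (e1 : sin (p / 2) = 0).
{ pose proof (cos_2a_sin (p / 2)) as e1; replace (2 * (p / 2)) with p in e1 by field.
  nra. }
destruct (sin_eq_0_0 _ e1) as [k hk]; pose proof PI_RGT_0.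
assert (0 < IZR k) by nra.
assert (0 < k)%Z by (apply lt_IZR; auto).
exists (Z.to_nat k); split; [lia|].
rewrite INR_IZR_INZ, Z2Nat.id by lia; lra.
Qed.

Lemma periodic_repr (X : Type) (g : R -> X) (p s : R) :
  0 < p -> (forall x, g (x + p) = g x) -> exists t, 0 <= t < p /\ g t = g s.
Proof.
intros hp hg.
assert (hn : forall n x, g (x + INR n * p) = g x).
{ intros n; induction n as [|n IH]; intros x.
  - simpl; f_equal; ring.
  - rewrite S_INR; replace (x + (INR n + 1) * p) with (x + INR n * p + p) by ring.
    rewrite hg; apply IH. }
(* Subtract floor(s/p) periods; its sign decides which of the two points is shifted by a natural
   number of periods. *)
destruct (base_Int_part (s / p)) as [h1 h2]; set (k := Int_part (s / p)) in *.
exists (s - IZR k * p); split.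
- assert (e : s = s / p * p) by (field; lra); split; nra.
- destruct (Z_le_gt_dec 0 k) as [hk|hk].
  + rewrite <- (hn (Z.to_nat k)); f_equal.
    rewrite INR_IZR_INZ, Z2Nat.id by lia; ring.
  + rewrite <- (hn (Z.to_nat (- k)) s); f_equal.
    rewrite INR_IZR_INZ, Z2Nat.id, opp_IZR by lia; ring.
Qed.

(** * The radius as a function of v = sin sigma *)

(* On the curve, with v = sin sigma, this is the denominator
   2H sn(r) - cs(r) sin sigma of the integrand. *)
Definition sqrt_disc (k H J v : R) : R := sqrt (v ^ 2 - J * (4 * H + k * J)).

(* The positive root T of (4H + kappa J) T^2 - 2 v T + J = 0, i.e. the value of
   sn(r/2)/cs(r/2) on the curve where v = sin sigma. *)
Definition tn_half (k H J v : R) : R := (v + sqrt_disc k H J v) / (4 * H + k * J).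

Lemma Xi_sign (k H J : R) : in_Xi k H J -> 0 < H /\ J < 0 /\ 0 < 4 * H + k * J.
Proof.
intros [h1 h2]; destruct (Rlt_dec 0 k) as [hk|hk].
- destruct (h1 hk) as [h3 [h4 h5]]; repeat split; auto.
  apply (Rmult_lt_compat_l k) in h4; auto.
  replace (k * - (4 * H / k)) with (- (4 * H)) in h4 by (field; lra); lra.
- apply Rnot_lt_le in hk; destruct (h2 hk) as [h3 h4].
  pose proof (sqrt_pos (- k)); repeat split; [lra|auto|nra].
Qed.

Lemma sqrt_disc_sq (k H J v : R) : in_Xi k H J ->
  0 < sqrt_disc k H J v /\ sqrt_disc k H J v ^ 2 = v ^ 2 - J * (4 * H + k * J).
Proof.
intros h; destruct (Xi_sign _ _ _ h) as [h1 [h2 h3]].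
assert (0 < v ^ 2 - J * (4 * H + k * J)) by (pose proof (pow2_ge_0 v); nra).
unfold sqrt_disc; split; [apply sqrt_lt_R0; auto|apply pow2_sqrt; lra].
Qed.

Lemma sqrt_disc_opp (k H J v : R) : sqrt_disc k H J (- v) = sqrt_disc k H J v.
Proof. unfold sqrt_disc; f_equal; ring. Qed.

Lemma tn_half_eq (k H J v : R) : in_Xi k H J ->
  (4 * H + k * J) * tn_half k H J v = v + sqrt_disc k H J v.
Proof. intros h; destruct (Xi_sign _ _ _ h) as [h1 [h2 h3]]; unfold tn_half; field; lra. Qed.

Lemma tn_half_pos (k H J v : R) : in_Xi k H J -> 0 < tn_half k H J v.
Proof.
intros h; destruct (Xi_sign _ _ _ h) as [h1 [h2 h3]].
destruct (sqrt_disc_sq k H J v h) as [h4 h5].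
apply Rdiv_lt_0_compat; auto; nra.
Qed.

Lemma tn_half_root (k H J v : R) : in_Xi k H J ->
  (4 * H + k * J) * tn_half k H J v ^ 2 = 2 * v * tn_half k H J v - J.
Proof.
intros h; destruct (Xi_sign _ _ _ h) as [h1 [h2 h3]].
destruct (sqrt_disc_sq k H J v h) as [h4 h5]; pose proof (tn_half_eq k H J v h) as e.
apply (Rmult_eq_reg_l (4 * H + k * J)); [|lra].
set (A := 4 * H + k * J) in *; set (T := tn_half k H J v) in *.
replace (A * (A * T ^ 2)) with ((A * T) ^ 2) by ring.
replace (A * (2 * v * T - J)) with (2 * v * (A * T) - J * A) by ring.
rewrite e; nra.
Qed.

(** Vieta: the second root of the quadratic equation at v is -T(-v). *)
Lemma tn_half_mul_opp (k H J v : R) : in_Xi k H J ->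
  (4 * H + k * J) * (tn_half k H J v * tn_half k H J (- v)) = - J.
Proof.
intros h; destruct (Xi_sign _ _ _ h) as [h1 [h2 h3]].
destruct (sqrt_disc_sq k H J v h) as [h4 h5].
pose proof (tn_half_eq k H J v h) as e; pose proof (tn_half_eq k H J (- v) h) as e'.
rewrite sqrt_disc_opp in e'; apply (Rmult_eq_reg_l (4 * H + k * J)); [|lra].
set (A := 4 * H + k * J) in *.
transitivity ((A * tn_half k H J v) * (A * tn_half k H J (- v))); [ring|].
rewrite e, e'; nra.
Qed.

(** The quadratic equation gives 2v = A T + J/T, which increases with T because A > 0 > J. *)
Lemma tn_half_incr (k H J v w : R) : in_Xi k H J -> v < w ->
  tn_half k H J v < tn_half k H J w.
Proof.
intros h hvw; destruct (Xi_sign _ _ _ h) as [h1 [h2 h3]].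
pose proof (tn_half_root k H J v h) as e; pose proof (tn_half_root k H J w h) as e'.
pose proof (tn_half_pos k H J v h); pose proof (tn_half_pos k H J w h).
pose proof (tn_half_mul_opp k H J v h).
set (A := 4 * H + k * J) in *; set (T := tn_half k H J v) in *.
set (S := tn_half k H J w) in *.
apply Rnot_le_lt; intros hle.
assert (hTS : 0 < T * S) by nra.
assert (v * (T * S) < w * (T * S)) by (apply Rmult_lt_compat_r; auto).
(* By the two quadratic equations this product equals 2(v - w)TS, which is negative. *)
assert (0 <= (T - S) * (A * (T * S) - J)) by (apply Rmult_le_pos; nra).
replace ((T - S) * (A * (T * S) - J))
  with ((A * T ^ 2 + J) * S - (A * S ^ 2 + J) * T) in * by ring.
rewrite e, e' in *; lra.
Qed.

Lemma tn_half_inj (k H J v w : R) : in_Xi k H J ->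
  tn_half k H J v = tn_half k H J w -> v = w.
Proof.
intros h e; destruct (Rtotal_order v w) as [hl|[hl|hl]]; auto;
  apply (tn_half_incr k H J _ _ h) in hl; lra.
Qed.

(** For k = -q^2 < 0 the bound H > q/2 enters: if q T >= 1, then 2HT > 1 >= v, and A T^2 - 2vT + J =
    2T(2HT - v) - J(q^2 T^2 - 1) would be positive instead of zero. *)
Lemma tn_half_range (k H J v : R) : in_Xi k H J -> v <= 1 ->
  0 < 1 + k * tn_half k H J v ^ 2.
Proof.
intros h hv; destruct (Xi_sign _ _ _ h) as [h1 [h2 h3]].
pose proof (tn_half_root k H J v h) as e; pose proof (tn_half_pos k H J v h) as hT.
set (T := tn_half k H J v) in *.
destruct (Rle_dec 0 k) as [hk|hk]; [pose proof (pow2_ge_0 T); nra|].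
destruct h as [_ h]; destruct (h ltac:(lra)) as [h4 _].
pose proof (sqrt_lt_R0 (- k) ltac:(lra)) as hq.
pose proof (sqrt_sqrt (- k) ltac:(lra)) as eq.
set (q := sqrt (- k)) in *; replace k with (- (q * q)) in * by lra.
apply Rnot_le_lt; intros hle.
assert (hqT : 0 < q * T) by nra.
assert (1 <= q * T).
{ assert (1 <= (q * T) ^ 2) by (rewrite Rpow_mult_distr; lra).
  nra. }
assert (1 < 2 * H * T) by nra.
assert (0 <= - J * (q * q * T ^ 2 - 1)) by (apply Rmult_le_pos; lra).
assert (0 < 2 * T * (2 * H * T - v)) by (apply Rmult_lt_0_compat; lra).
nra.
Qed.

(** Monotonicity of sn(r/2)/cs(r/2), cleared of denominators: the difference of the two sides is
    sn((s - r)/2). *)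
Lemma half_angle_lt (k r s : R) : in_I k r -> in_I k s -> r < s ->
  sn k (r / 2) * cs k (s / 2) < sn k (s / 2) * cs k (r / 2).
Proof.
intros hr hs hlt.
assert (h : 0 < sn k (s / 2 - r / 2)).
{ apply sn_pos, (in_I_lt k s); auto; destruct hr; lra. }
rewrite sn_minus in h; lra.
Qed.

(** Supplies the existence and uniqueness behind [iota]; afterwards the radius is handled only
    through its half-angle tangent. *)
Lemma radius_spec (k H J s : R) : in_Xi k H J ->
  in_I k (radius k H J s) /\
  sn k (radius k H J s / 2) = tn_half k H J (sin s) * cs k (radius k H J s / 2).
Proof.
intros h; destruct (Xi_sign _ _ _ h) as [h1 [h2 h3]].
pose proof (tn_half_root k H J (sin s) h) as e; pose proof (tn_half_pos k H J (sin s) h) as hT.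
pose proof (SIN_bound s) as hs.
pose proof (tn_half_range k H J (sin s) h (proj2 hs)) as hr.
set (T := tn_half k H J (sin s)) in *.
destruct (ex_half_angle k T hT hr) as [r [hr1 hr2]].
assert (hrad : radius k H J s = r); [|rewrite hrad; auto].
apply (iota_unique (V := R_CompleteNormedModule)).
- intros y [hy1 hy2]; rewrite first_integral_half in hy2.
  pose proof (cs_half_pos k y hy1) as hc; pose proof (cs_half_pos k r hr1) as hc'.
  pose proof (cs2_sn2 k (y / 2)) as hsq.
  assert (hsn : 0 < sn k (y / 2)) by (apply sn_pos, (in_I_lt k y); auto; destruct hy1; lra).
  assert (e2 : sn k (y / 2) = T * cs k (y / 2)).
  { set (a := sn k (y / 2)) in *; set (c := cs k (y / 2)) in *.
    (* a/c and T are both the positive root of the quadratic equation *)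
    assert (e3 : (4 * H + k * J) * a ^ 2 = 2 * sin s * a * c - J * c ^ 2) by nra.
    assert (e4 : (a - T * c) * ((4 * H + k * J) * T * a - J * c) = 0).
    { replace ((a - T * c) * ((4 * H + k * J) * T * a - J * c)) with
        (T * ((4 * H + k * J) * a ^ 2) - ((4 * H + k * J) * T ^ 2) * (a * c)
         - J * a * c + J * T * c ^ 2) by ring.
      rewrite e3, e; ring. }
    apply Rmult_integral in e4; destruct e4 as [e4|e4]; [lra|].
    assert (0 < (4 * H + k * J) * T * a) by (apply Rmult_lt_0_compat; [apply Rmult_lt_0_compat|]; auto).
    nra. }
  destruct (Rtotal_order y r) as [hl|[hl|hl]]; auto;
    apply (half_angle_lt k) in hl; auto; rewrite e2, hr2 in hl; lra.
- split; auto; rewrite first_integral_half, hr2.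
  pose proof (cs2_sn2 k (r / 2)) as hsq; rewrite hr2 in hsq.
  set (c := cs k (r / 2)) in *; nra.
Qed.

Lemma cs_half_sq (k H J s : R) : in_Xi k H J ->
  cs k (radius k H J s / 2) ^ 2 * (1 + k * tn_half k H J (sin s) ^ 2) = 1.
Proof.
intros h; destruct (radius_spec k H J s h) as [h1 h2].
pose proof (cs2_sn2 k (radius k H J s / 2)) as e; rewrite h2 in e; lra.
Qed.

Lemma radius_lt (k H J s t : R) : in_Xi k H J ->
  radius k H J s < radius k H J t -> sin s < sin t.
Proof.
intros h hl; destruct (radius_spec k H J s h) as [h1 h2].
destruct (radius_spec k H J t h) as [h3 h4].
pose proof (half_angle_lt _ _ _ h1 h3 hl) as hlt; rewrite h2, h4 in hlt.
pose proof (cs_half_pos k _ h1) as hc; pose proof (cs_half_pos k _ h3) as hc'.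
apply Rnot_le_lt; intros [hle|hle].
- apply (tn_half_incr k H J _ _ h) in hle.
  apply (Rmult_lt_compat_r _ _ _ (Rmult_lt_0_compat _ _ hc hc')) in hle; lra.
- rewrite hle in hlt; lra.
Qed.

Lemma radius_sin (k H J s t : R) : sin s = sin t -> radius k H J s = radius k H J t.
Proof. intros e; unfold radius, first_integral; rewrite e; reflexivity. Qed.

Lemma radius_inj (k H J s t : R) : in_Xi k H J ->
  radius k H J s = radius k H J t -> sin s = sin t.
Proof.
intros h e; apply (tn_half_inj k H J _ _ h).
destruct (radius_spec k H J s h) as [h1 h2].
destruct (radius_spec k H J t h) as [h3 h4].
pose proof (cs_half_pos k _ h1) as hc; rewrite e in *.
rewrite h2 in h4; apply (Rmult_eq_reg_r (cs k (radius k H J t / 2))); lra.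
Qed.

(** * The integrand as a function of v = sin sigma *)

(* In terms of v = sin sigma, [sn2_half] is sn(r/2)^2 and [speed_sq] the radicand
   of the integrand. *)
Definition sn2_half (k H J v : R) : R := tn_half k H J v ^ 2 / (1 + k * tn_half k H J v ^ 2).

Definition speed_sq (k tau a H J v : R) : R :=
  4 * sn2_half k H J v * (1 - k * sn2_half k H J v) + (4 * tau * sn2_half k H J v - a) ^ 2.

Definition slope (k tau a H J v : R) : R :=
  sqrt (speed_sq k tau a H J v) / sqrt_disc k H J v * v.

(** With c = cs(r/2), the double-angle formulas give sn r = 2T c^2 and cs r = (1 - kT^2) c^2, where
    c^2 = 1/(1 + kT^2). *)
Lemma dheight_slope (k tau a H J s : R) : in_Xi k H J ->
  dheight k tau a H J s = slope k tau a H J (sin s).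
Proof.
intros h; destruct (Xi_sign _ _ _ h) as [h1 [h2 h3]].
destruct (radius_spec k H J s h) as [h4 h5]; pose proof (cs_half_sq k H J s h) as e.
pose proof (tn_half_root k H J (sin s) h) as e1; pose proof (tn_half_eq k H J (sin s) h) as e2.
pose proof (tn_half_pos k H J (sin s) h) as hT.
pose proof (tn_half_range k H J (sin s) h (proj2 (SIN_bound s))) as hr.
unfold dheight, slope, speed_sq, sn2_half; cbv zeta.
set (r := radius k H J s) in *; set (T := tn_half k H J (sin s)) in *.
set (c := cs k (r / 2)) in *.
assert (ec : c ^ 2 = / (1 + k * T ^ 2)).
{ apply (Rmult_eq_reg_r (1 + k * T ^ 2)); [|lra]; rewrite e; field; lra. }
assert (es : sn k r = 2 * T * c ^ 2).
{ replace r with (r / 2 + r / 2) by field; rewrite sn_plus; fold c; rewrite h5; ring. }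
assert (ecs : cs k r = (1 - k * T ^ 2) * c ^ 2).
{ replace r with (r / 2 + r / 2) by field; rewrite cs_plus; fold c; rewrite h5; ring. }
f_equal; f_equal.
- f_equal; rewrite es, h5, (Rpow_mult_distr T c), ec; field; lra.
- rewrite es, ecs, ec; apply (Rmult_eq_reg_r (1 + k * T ^ 2)); [|lra].
  field_simplify; [|lra]; set (D := sqrt_disc k H J (sin s)) in *.
  replace D with ((4 * H + k * J) * T - sin s) by lra.
  (* The quadratic equation lowers the cubic term in T, which turns the denominator into
     [sqrt_disc]. *)
  assert (k * T * ((4 * H + k * J) * T ^ 2) = k * T * (2 * sin s * T - J))
    by (rewrite e1; ring).
  nra.
Qed.

Lemma sn2_half_pos (k H J v : R) : in_Xi k H J -> v <= 1 ->
  0 < sn2_half k H J v * (1 - k * sn2_half k H J v).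
Proof.
intros h hv; pose proof (tn_half_range k H J v h hv) as hr.
pose proof (tn_half_pos k H J v h) as hT; unfold sn2_half.
set (T := tn_half k H J v) in *.
replace (T ^ 2 / (1 + k * T ^ 2) * (1 - k * (T ^ 2 / (1 + k * T ^ 2))))
  with (T ^ 2 / (1 + k * T ^ 2) ^ 2) by (field; lra).
apply Rdiv_lt_0_compat; apply pow_lt; auto.
Qed.

Lemma speed_sq_pos (k tau a H J v : R) : in_Xi k H J -> v <= 1 ->
  0 < speed_sq k tau a H J v.
Proof.
intros h hv; pose proof (sn2_half_pos k H J v h hv); unfold speed_sq.
pose proof (pow2_ge_0 (4 * tau * sn2_half k H J v - a)); lra.
Qed.

(** The closed form in sin s replaces [iota]; all its radicands and denominators are positive, so it
    is differentiable. *)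
Lemma dheight_continuous (k tau a H J : R) : in_Xi k H J ->
  forall s : R, continuous (dheight k tau a H J) s.
Proof.
intros h s.
apply (continuous_ext (fun s : R => slope k tau a H J (sin s))).
{ intros x; symmetry; apply dheight_slope, h. }
pose proof (speed_sq_pos k tau a H J (sin s) h (proj2 (SIN_bound s))) as h1.
pose proof (tn_half_range k H J (sin s) h (proj2 (SIN_bound s))) as h2.
destruct (sqrt_disc_sq k H J (sin s) h) as [h3 h4].
assert (h5 : 0 < sin s ^ 2 - J * (4 * H + k * J)) by (rewrite <- h4; apply pow_lt, h3).
destruct (Xi_sign _ _ _ h) as [_ [_ h6]].
apply (ex_derive_continuous (V := R_NormedModule)).
unfold slope, speed_sq, sn2_half, tn_half, sqrt_disc in *.
auto_derive.
repeat split; try (apply Rgt_not_eq); auto.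
Qed.

(** [speed_sq] is a quadratic polynomial in [sn2_half], so the difference of two values splits off
    the difference of the arguments. *)
Lemma speed_sq_diff (k tau a H J v : R) :
  speed_sq k tau a H J v - speed_sq k tau a H J (- v)
  = (sn2_half k H J v - sn2_half k H J (- v))
    * (4 - 8 * a * tau
       + (16 * tau ^ 2 - 4 * k) * (sn2_half k H J v + sn2_half k H J (- v))).
Proof. unfold speed_sq; ring. Qed.

Lemma sn2_half_incr (k H J v w : R) : in_Xi k H J -> v < w -> w <= 1 ->
  sn2_half k H J v < sn2_half k H J w.
Proof.
intros h hv hw; unfold sn2_half.
pose proof (tn_half_incr k H J v w h hv) as h1.
pose proof (tn_half_pos k H J v h) as h2.
pose proof (tn_half_range k H J v h ltac:(lra)) as h3.
pose proof (tn_half_range k H J w h hw) as h4.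
set (T := tn_half k H J v) in *; set (S := tn_half k H J w) in *.
apply Rlt_0_minus.
replace (S ^ 2 / (1 + k * S ^ 2) - T ^ 2 / (1 + k * T ^ 2))
  with ((S - T) * (S + T) / ((1 + k * S ^ 2) * (1 + k * T ^ 2))) by (field; lra).
apply Rdiv_lt_0_compat; apply Rmult_lt_0_compat; lra.
Qed.

(** The left side is (1 - (kTS)^2) / ((1 + kT^2)(1 + kS^2)). Inserting TS = -J/A leaves A^2 - (kJ)^2
    = 4H(4H + 2kJ), which also yields the witness for m. *)
Lemma sn2_half_sum (k H J v : R) : in_Xi k H J -> -1 <= v <= 1 ->
  exists m, 0 < m /\
  1 - k * (sn2_half k H J v + sn2_half k H J (- v)) = m * (4 * H + 2 * k * J).
Proof.
intros h hv; destruct (Xi_sign _ _ _ h) as [h0 [h1 h2]]; unfold sn2_half.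
pose proof (tn_half_mul_opp k H J v h) as e.
pose proof (tn_half_range k H J v h ltac:(lra)) as h3.
pose proof (tn_half_range k H J (- v) h ltac:(lra)) as h4.
set (T := tn_half k H J v) in *; set (S := tn_half k H J (- v)) in *.
set (A := 4 * H + k * J) in *.
exists (4 * H / (A ^ 2 * ((1 + k * T ^ 2) * (1 + k * S ^ 2)))); split.
- apply Rdiv_lt_0_compat; [lra|].
  apply Rmult_lt_0_compat; [apply pow_lt, h2|apply Rmult_lt_0_compat; auto].
- replace (1 - k * (T ^ 2 / (1 + k * T ^ 2) + S ^ 2 / (1 + k * S ^ 2)))
    with ((A ^ 2 - (k * (A * (T * S))) ^ 2) / (A ^ 2 * ((1 + k * T ^ 2) * (1 + k * S ^ 2))))
    by (field; lra).
  rewrite e; unfold A; field; fold A; lra.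
Qed.

(** * The closing condition of a tube *)

Lemma sin_2PI_shift (s : R) : sin (s + 2 * PI) = sin s.
Proof. rewrite sin_plus, sin_2PI, cos_2PI; ring. Qed.

Lemma dheight_period (k tau a H J s : R) : in_Xi k H J ->
  dheight k tau a H J (s + 2 * PI) = dheight k tau a H J s.
Proof. intros h; rewrite !dheight_slope, sin_2PI_shift by auto; auto. Qed.

(** The radius at PI/2 + P equals that at PI/2, so cos P = 1 and P is n > 0 full turns; the height
    gained over them is n times the integral. *)
Lemma tube_closing (k tau a H J : R) : screw_motion_tube k tau a H J ->
  RInt (dheight k tau a H J) (- PI) PI = 0.
Proof.
intros [h [_ [P [hP [hper _]]]]].
assert (hr : forall s, radius k H J (s + P) = radius k H J s)
  by (intros s; apply (f_equal fst (hper s))).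
assert (hc : cos P = 1).
{ pose proof (radius_inj _ _ _ _ _ h (hr (PI / 2))) as e.
  rewrite sin_PI2, Rplus_comm in e.
  rewrite <- e, sin_plus, cos_PI2, sin_PI2; ring. }
destruct (cos_eq_1_period P hP hc) as [n [hn ->]].
pose proof (f_equal snd (hper (PI / 2))) as e; simpl in e; unfold height in e.
rewrite RInt_same, RInt_nperiod in e.
- apply lt_INR in hn; simpl in hn; apply Rmult_integral in e; destruct e; lra.
- apply dheight_continuous, h.
- intros x; apply dheight_period, h.
Qed.

(** Folding at 0 turns the integrand into (Q(v) - Q(-v)) v with v = sin s > 0, so a constant sign of
    Q(v)^2 - Q(-v)^2 prevents closing. *)
Lemma closing_speed (k tau a H J c : R) : in_Xi k H J ->
  RInt (dheight k tau a H J) (- PI) PI = 0 ->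
  ~ (forall v, 0 < v <= 1 -> 0 < c * (speed_sq k tau a H J v - speed_sq k tau a H J (- v))).
Proof.
intros h h0 hpos; revert h0; pose proof PI_RGT_0 as hpi.
apply (RInt_sym_neq0 _ c); auto; [apply dheight_continuous, h|].
intros s hs; rewrite !dheight_slope, sin_neg by auto; unfold slope.
assert (hv : 0 < sin s) by (apply sin_gt_0; lra).
destruct (SIN_bound s) as [_ hv'].
specialize (hpos _ (conj hv hv')).
pose proof (speed_sq_pos k tau a H J (sin s) h ltac:(lra)) as h1.
pose proof (speed_sq_pos k tau a H J (- sin s) h ltac:(lra)) as h2.
destruct (sqrt_disc_sq k H J (sin s) h) as [h3 _]; rewrite sqrt_disc_opp.
set (v := sin s) in *; set (D := sqrt_disc k H J v) in *.
pose proof (sqrt_lt_R0 _ h1) as h4; pose proof (sqrt_lt_R0 _ h2) as h5.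
rewrite <- (pow2_sqrt _ (Rlt_le _ _ h1)), <- (pow2_sqrt _ (Rlt_le _ _ h2)) in hpos.
set (p := sqrt (speed_sq k tau a H J v)) in *.
set (q := sqrt (speed_sq k tau a H J (- v))) in *.
(* Uses p - q = (p^2 - q^2)/(p + q). *)
replace (c * (p / D * v + q / D * - v))
  with (c * (p ^ 2 - q ^ 2) * v / (D * (p + q))) by (field; lra).
apply Rdiv_lt_0_compat; apply Rmult_lt_0_compat; lra.
Qed.

(** * Curves centred at the equator *)

(* 4H + 2 kappa J = 0 says that the curve is centred at the equator
   r = PI / (2 sqrt kappa). *)
Lemma equator_kappa (k H J : R) : in_Xi k H J -> 4 * H + 2 * k * J = 0 -> 0 < k.
Proof. intros h e; destruct (Xi_sign _ _ _ h) as [h0 [h1 h2]]; nra. Qed.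

(** Here k T(v) T(-v) = 1, so [cs] vanishes at half the sum of the two radii. *)
Lemma equator_radius (k H J s : R) : in_Xi k H J -> 4 * H + 2 * k * J = 0 ->
  radius k H J s + radius k H J (- s) = PI / sqrt k.
Proof.
intros h e; pose proof (equator_kappa _ _ _ h e) as hk.
destruct (Xi_sign _ _ _ h) as [h0 [h1 h2]].
destruct (radius_spec k H J s h) as [[h3 h3'] h4].
destruct (radius_spec k H J (- s) h) as [[h5 h5'] h6]; rewrite sin_neg in h6.
specialize (h3' hk); specialize (h5' hk).
pose proof (tn_half_mul_opp k H J (sin s) h) as e1.
assert (e2 : cs k (radius k H J s / 2 + radius k H J (- s) / 2) = 0).
{ rewrite cs_plus, h4, h6.
  assert (e3 : k * (tn_half k H J (sin s) * tn_half k H J (- sin s)) = 1).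
  { apply (Rmult_eq_reg_l (4 * H + k * J)); [|lra].
    transitivity (k * ((4 * H + k * J) * (tn_half k H J (sin s) * tn_half k H J (- sin s))));
      [ring|rewrite e1; lra]. }
  set (c := cs k _); set (c' := cs k _).
  transitivity (c * c' * (1 - k * (tn_half k H J (sin s) * tn_half k H J (- sin s))));
    [ring|rewrite e3; ring]. }
unfold cs in e2; destruct (Rlt_dec 0 k) as [_|]; [|lra].
pose proof (sqrt_lt_R0 k hk) as hq; set (q := sqrt k) in *.
set (r := radius k H J s) in *; set (r' := radius k H J (- s)) in *.
apply Rlt_div_r in h3'; auto; apply Rlt_div_r in h5'; auto.
(* The angle lies in (0, PI), which leaves PI/2 as the only zero of the cosine. *)
assert (hp : 0 < q * (r / 2 + r' / 2)) by (apply Rmult_lt_0_compat; lra).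
apply cos_eq_0_2PI_0 in e2; [|lra|lra].
apply (Rmult_eq_reg_l q); [|lra].
replace (q * (PI / q)) with PI by (field; lra); destruct e2; lra.
Qed.

(** The addition laws for r1/2 + r2/2 = r0 give ab(T + S) = 2c^2 U and ab(1 - kTS) = c^2(1 - kU^2),
    while TS = U^2 by [tn_half_mul_opp] at 1 and at 0. *)
Lemma equator_of_midpoint (k H J : R) : in_Xi k H J ->
  radius k H J (PI / 2) + radius k H J (- (PI / 2)) = 2 * radius k H J 0 ->
  4 * H + 2 * k * J = 0.
Proof.
intros h hr; destruct (Xi_sign _ _ _ h) as [h0 [h1 h2]].
destruct (radius_spec k H J (PI / 2) h) as [i1 e1].
destruct (radius_spec k H J (- (PI / 2)) h) as [i2 e2].
destruct (radius_spec k H J 0 h) as [i3 e3].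
rewrite sin_neg in e2; rewrite sin_PI2 in *; rewrite sin_0 in e3.
pose proof (tn_half_mul_opp k H J 1 h) as e4; pose proof (tn_half_mul_opp k H J 0 h) as e5.
rewrite Ropp_0 in e5.
pose proof (tn_half_incr k H J (-1) 1 h ltac:(lra)) as h3.
pose proof (cs_half_pos k _ i1) as c1; pose proof (cs_half_pos k _ i2) as c2.
set (r1 := radius k H J (PI / 2)) in *; set (r2 := radius k H J (- (PI / 2))) in *.
set (r0 := radius k H J 0) in *.
assert (es : sn k (r1 / 2 + r2 / 2) = sn k (r0 / 2 + r0 / 2)) by (f_equal; lra).
assert (ec : cs k (r1 / 2 + r2 / 2) = cs k (r0 / 2 + r0 / 2)) by (f_equal; lra).
rewrite !sn_plus, e1, e2, e3 in es; rewrite !cs_plus, e1, e2, e3 in ec.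
replace (-1) with (- (1)) in h3 by ring.
set (T := tn_half k H J 1) in *; set (S := tn_half k H J (- (1))) in *.
set (U := tn_half k H J 0) in *.
set (a := cs k (r1 / 2)) in *; set (b := cs k (r2 / 2)) in *; set (c := cs k (r0 / 2)) in *.
assert (eTS : T * S = U * U) by (apply (Rmult_eq_reg_l (4 * H + k * J)); lra).
assert (em : (1 - k * (U * U)) * (a * b - c * c) = 0).
{ transitivity (a * b * (1 - k * (U * U)) - c * c * (1 - k * (U * U))); [ring|].
  rewrite <- eTS at 1; lra. }
apply Rmult_integral in em; destruct em as [em|em].
- replace (4 * H + 2 * k * J) with ((4 * H + k * J) - k * (- J)) by ring.
  rewrite <- e5.
  transitivity ((4 * H + k * J) * (1 - k * (U * U))); [ring|rewrite em; ring].
(* If ab = c^2, then T and S have equal arithmetic and geometric means, so T = S, against strict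
   monotonicity. *)
- exfalso; assert (hab : 0 < a * b) by (apply Rmult_lt_0_compat; auto).
  assert (eTS' : T + S = 2 * U).
  { apply (Rmult_eq_reg_r (a * b)); [|lra].
    transitivity (2 * U * (c * c)); [lra|f_equal; lra]. }
  assert (0 < (T - S) ^ 2) by (apply pow_lt; lra).
  nra.
Qed.

(** * Reflections of the profile curve *)

Lemma height_flip (k tau a H J s : R) : in_Xi k H J ->
  height k tau a H J (PI - s) = - height k tau a H J s.
Proof.
intros h; pose proof (dheight_continuous k tau a H J h) as hc; unfold height.
pose proof (RInt_reflect (dheight k tau a H J) s (PI / 2) PI hc) as e.
replace (PI - PI / 2) with (PI / 2) in e by field; rewrite e.
pose proof (RInt_split (dheight k tau a H J) (PI / 2) s (PI / 2) hc) as e1.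
rewrite RInt_same in e1.
rewrite (RInt_ext (V := R_CompleteNormedModule) _ (dheight k tau a H J)); [lra|].
intros x _; rewrite !dheight_slope, sin_minus, sin_PI, cos_PI by auto.
f_equal; ring.
Qed.

(** The parameter change s -> PI - s keeps sin s and fixes the base point PI/2 of the height, so it
    realizes the reflection at h = 0. *)
Lemma symmetric_h_profile (k tau a H J : R) : in_Xi k H J ->
  symmetric_h (trace (profile k tau a H J)).
Proof.
intros h; exists 0.
assert (hs : forall s, profile k tau a H J (PI - s) = reflect_h 0 (profile k tau a H J s)).
{ intros s; unfold profile, reflect_h; simpl; rewrite height_flip by auto; f_equal; [|ring].
  apply radius_sin; rewrite sin_minus, sin_PI, cos_PI; ring. }
assert (hi : forall p, reflect_h 0 (reflect_h 0 p) = p)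
  by (intros [x y]; unfold reflect_h; simpl; f_equal; ring).
intros p; split; intros [s e]; exists (PI - s); rewrite hs, e; auto.
Qed.

(** The integrand has the sign of sin s: the height rises strictly up to PI and falls strictly after
    it. The conclusion sin s = 0 is what determines the radius there. *)
Lemma height_max (k tau a H J s : R) : in_Xi k H J -> 0 <= s < 2 * PI ->
  height k tau a H J s = height k tau a H J PI -> sin s = 0.
Proof.
intros h hs e; pose proof PI_RGT_0 as hpi.
pose proof (dheight_continuous k tau a H J h) as hc; unfold height in e.
assert (hsl : forall v, -1 <= v <= 1 -> v <> 0 -> 0 < v * slope k tau a H J v).
{ intros v hv hv0; unfold slope; destruct (sqrt_disc_sq k H J v h) as [h1 _].
  pose proof (sqrt_lt_R0 _ (speed_sq_pos k tau a H J v h (proj2 hv))) as h2.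
  replace (v * (sqrt (speed_sq k tau a H J v) / sqrt_disc k H J v * v))
    with (v ^ 2 * (sqrt (speed_sq k tau a H J v) / sqrt_disc k H J v)) by (field; lra).
  apply Rmult_lt_0_compat; [apply pow2_gt_0, hv0|apply Rdiv_lt_0_compat; auto]. }
destruct (Rtotal_order s PI) as [hl|[->|hl]]; [|apply sin_PI|].
- destruct (Req_dec s 0) as [->|hs0]; [apply sin_0|exfalso].
  rewrite (RInt_split _ (PI / 2) s PI hc) in e.
  enough (0 < RInt (dheight k tau a H J) s PI) by lra.
  apply RInt_gt_0; auto; intros x hx; rewrite dheight_slope by auto.
  assert (0 < sin x) by (apply sin_gt_0; lra).
  specialize (hsl _ (SIN_bound x) ltac:(lra)); nra.
- exfalso; rewrite (RInt_split _ (PI / 2) PI s hc) in e.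
  enough (0 < RInt (fun x => - dheight k tau a H J x) PI s) as h0.
  { rewrite (RInt_opp (V := R_CompleteNormedModule) (dheight k tau a H J)) in h0
      by (apply ex_RInt_cont, hc).
    unfold opp in h0; simpl in h0; lra. }
  apply RInt_gt_0; auto; intros x hx.
  + rewrite dheight_slope by auto.
    assert (sin x < 0) by (apply sin_lt_0; lra).
    specialize (hsl _ (SIN_bound x) ltac:(lra)); nra.
  + apply (continuous_opp (V := R_NormedModule)), hc.
Qed.

Lemma profile_period (k tau a H J s : R) : screw_motion_tube k tau a H J ->
  profile k tau a H J (s + 2 * PI) = profile k tau a H J s.
Proof.
intros htube; pose proof (tube_closing _ _ _ _ _ htube) as h0; destruct htube as [h _].
pose proof (dheight_continuous k tau a H J h) as hc.
unfold profile; f_equal; [apply radius_sin, sin_2PI_shift|unfold height].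
rewrite (RInt_split _ (PI / 2) s _ hc), RInt_period, h0; auto; [apply Rplus_0_r|].
intros x; apply dheight_period, h.
Qed.

Lemma radius_le (k H J s t : R) : in_Xi k H J -> sin s <= sin t ->
  radius k H J s <= radius k H J t.
Proof.
intros h hl; apply Rnot_lt_le; intros hlt; apply (radius_lt k H J _ _ h) in hlt; lra.
Qed.

(** The mirror image of each point lies on the curve at the same height; the three points below show
    that r0 is both the midpoint of the extremal radii and the radius at maximal height. *)
Lemma equator_of_symmetric_r (k tau a H J : R) : screw_motion_tube k tau a H J ->
  symmetric_r k (trace (profile k tau a H J)) -> 4 * H + 2 * k * J = 0.
Proof.
intros htube [r0 [_ hinv]]; pose proof (proj1 htube) as h.
apply equator_of_midpoint; auto.
assert (hs : forall s, exists t, 0 <= t < 2 * PI /\ radius k H J t = 2 * r0 - radius k H J s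
  /\ height k tau a H J t = height k tau a H J s).
{ intros s; destruct (proj2 (hinv (profile k tau a H J s))) as [t e]; [exists s; auto|].
  pose proof PI_RGT_0.
  destruct (periodic_repr _ (profile k tau a H J) (2 * PI) t) as [t' [ht e']]; [lra| |].
  { intros x; apply profile_period, htube. }
  rewrite e in e'; exists t'; split; auto.
  split; [apply (f_equal fst e')|apply (f_equal snd e')]. }
(* The images of the outermost and innermost points bound 2 r0 from below and above by the sum of
   the extremal radii; the image of the highest point again has sin = 0, so its radius is r0. *)
destruct (hs (PI / 2)) as [t1 [_ [e1 _]]]; destruct (hs (- (PI / 2))) as [t2 [_ [e2 _]]].
destruct (hs PI) as [t3 [b3 [e3 e3']]].
apply height_max in e3'; auto.
rewrite (radius_sin k H J t3 0), (radius_sin k H J PI 0) in e3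
  by (rewrite ?sin_0, ?sin_PI; auto).
assert (radius k H J (- (PI / 2)) <= radius k H J t1)
  by (apply radius_le; auto; rewrite sin_neg, sin_PI2; apply SIN_bound).
assert (radius k H J t2 <= radius k H J (PI / 2))
  by (apply radius_le; auto; rewrite sin_PI2; apply SIN_bound).
lra.
Qed.

(** * The pitch condition and the equator *)

Lemma equator_closing (k tau a H J : R) : in_Xi k H J -> 4 * H + 2 * k * J = 0 ->
  RInt (dheight k tau a H J) (- PI) PI = 0 -> 2 * tau ^ 2 - a * tau * k = 0.
Proof.
intros h e h0; pose proof (equator_kappa _ _ _ h e) as hk.
destruct (Req_dec (2 * tau ^ 2 - a * tau * k) 0) as [hz|hz]; auto; exfalso.
(* As x + y = 1/k, the last factor of [speed_sq_diff] is 8/k times this constant, so their product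
   is a positive multiple of a square. *)
apply (closing_speed k tau a H J (2 * tau ^ 2 - a * tau * k) h h0).
intros v hv; rewrite speed_sq_diff.
destruct (sn2_half_sum k H J v h ltac:(lra)) as [m [_ es]]; rewrite e, Rmult_0_r in es.
pose proof (sn2_half_incr k H J (- v) v h ltac:(lra) ltac:(lra)) as hi.
set (x := sn2_half k H J v) in *; set (y := sn2_half k H J (- v)) in *.
replace (x + y) with (/ k) by (apply (Rmult_eq_reg_l k); [field_simplify; lra|lra]).
replace ((2 * tau ^ 2 - a * tau * k)
    * ((x - y) * (4 - 8 * a * tau + (16 * tau ^ 2 - 4 * k) * / k)))
  with ((2 * tau ^ 2 - a * tau * k) ^ 2 * (8 * (x - y) / k)) by (field; lra).
apply Rmult_lt_0_compat; [apply pow2_gt_0, hz|apply Rdiv_lt_0_compat; lra].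
Qed.

(** The last factor of [speed_sq_diff] becomes b m (4H + 2kJ) with m > 0, whose sign does not depend
    on v. The hypothesis k <> 4 tau^2 gives b <> 0 when tau <> 0. *)
Lemma equator_of_pitch (k tau a H J : R) : in_Xi k H J -> k <> 4 * tau ^ 2 ->
  2 * tau ^ 2 - a * tau * k = 0 ->
  RInt (dheight k tau a H J) (- PI) PI = 0 -> 4 * H + 2 * k * J = 0.
Proof.
intros h hne hz h0.
destruct (Req_dec (4 * H + 2 * k * J) 0) as [e|e]; auto; exfalso.
(* Under the pitch condition the squared speed is affine in sn(r)^2, with slope [b]. *)
assert (hb : exists b, b <> 0 /\ forall z, 4 - 8 * a * tau + (16 * tau ^ 2 - 4 * k) * z
  = b * (1 - k * z)).
{ destruct (Req_dec tau 0) as [->|ht].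
  - exists 4; split; [lra|intros z; ring].
  - assert (ea : 2 * tau = a * k) by (apply (Rmult_eq_reg_l tau); [lra|exact ht]).
    assert (hk : k <> 0) by (intros ->; apply ht; lra).
    exists (4 - 16 * tau ^ 2 / k); split.
    + intros eb; apply hne; apply (f_equal (fun z => z * k / 4)) in eb.
      field_simplify in eb; lra.
    + intros z; replace a with (2 * tau / k) by (rewrite ea; field; auto); field; auto. }
destruct hb as [b [hb eb]].
(* This multiplier matches the sign of the factor, so squares appear. *)
apply (closing_speed k tau a H J (b * (4 * H + 2 * k * J)) h h0).
intros v hv; rewrite speed_sq_diff, eb.
destruct (sn2_half_sum k H J v h ltac:(lra)) as [m [hm es]]; rewrite es.
pose proof (sn2_half_incr k H J (- v) v h ltac:(lra) ltac:(lra)) as hi.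
set (x := sn2_half k H J v) in *; set (y := sn2_half k H J (- v)) in *.
set (w := 4 * H + 2 * k * J) in *.
replace (b * w * ((x - y) * (b * (m * w)))) with (b ^ 2 * w ^ 2 * ((x - y) * m)) by ring.
apply Rmult_lt_0_compat; apply Rmult_lt_0_compat; try (apply pow2_gt_0); auto; lra.
Qed.

Lemma equator_speed (k tau a H J v : R) : in_Xi k H J -> 4 * H + 2 * k * J = 0 ->
  2 * tau ^ 2 - a * tau * k = 0 -> -1 <= v <= 1 ->
  speed_sq k tau a H J (- v) = speed_sq k tau a H J v.
Proof.
intros h e hz hv; pose proof (equator_kappa _ _ _ h e) as hk.
symmetry; apply Rminus_diag_uniq; rewrite speed_sq_diff.
destruct (sn2_half_sum k H J v h hv) as [m [_ es]]; rewrite e, Rmult_0_r in es.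
set (x := sn2_half k H J v) in *; set (y := sn2_half k H J (- v)) in *.
replace (x + y) with (/ k) by (apply (Rmult_eq_reg_l k); [field_simplify; lra|lra]).
replace (4 - 8 * a * tau + (16 * tau ^ 2 - 4 * k) * / k)
  with (8 * (2 * tau ^ 2 - a * tau * k) / k) by (field; lra).
rewrite hz; field; lra.
Qed.

Lemma symmetric_r_of_pitch (k tau a H J : R) : in_Xi k H J -> 4 * H + 2 * k * J = 0 ->
  2 * tau ^ 2 - a * tau * k = 0 -> symmetric_r k (trace (profile k tau a H J)).
Proof.
intros h e hz; pose proof (equator_kappa _ _ _ h e) as hk.
pose proof (sqrt_lt_R0 k hk) as hq; pose proof PI_RGT_0 as hpi.
pose proof (dheight_continuous k tau a H J h) as hc.
set (r0 := PI / sqrt k / 2); exists r0; split.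
{ assert (0 < PI / sqrt k) by (apply Rdiv_lt_0_compat; auto).
  unfold r0; split; [lra|intros _; lra]. }
(* s -> -s is the reflection: radii add up to PI/sqrt k, and the integrand is odd because the speed
   is even in v, so the heights at s and -s agree. *)
assert (hs : forall s, profile k tau a H J (- s) = reflect_r r0 (profile k tau a H J s)).
{ intros s; unfold profile, reflect_r, r0; simpl; f_equal.
  - rewrite <- (equator_radius k H J s h e); field.
  - unfold height; rewrite (RInt_split _ (PI / 2) (- s) s hc).
    rewrite RInt_odd; [symmetry; apply Rplus_0_r|auto|].
    intros x; rewrite !dheight_slope, sin_neg by auto; unfold slope.
    rewrite equator_speed, sqrt_disc_opp by (auto; apply SIN_bound); ring. }
assert (hi : forall p, reflect_r r0 (reflect_r r0 p) = p)
  by (intros [x y]; unfold reflect_r; simpl; f_equal; ring).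
intros p; split; intros [s es]; exists (- s); rewrite hs, es; auto.
Qed.

Theorem proposition3p10 (kappa tau a : R)
  (Htau : 0 <= tau) (Hkappa : kappa <> 4 * tau ^ 2)
  (H J : R) (Htube : screw_motion_tube kappa tau a H J) :
  (dihedral_order4 kappa (trace (profile kappa tau a H J))
     <-> 2 * tau ^ 2 - a * tau * kappa = 0)
  /\
  (2 * tau ^ 2 - a * tau * kappa <> 0 ->
     only_dihedral_order2 kappa (trace (profile kappa tau a H J))).
Proof.
pose proof (tube_closing _ _ _ _ _ Htube) as h0; pose proof (proj1 Htube) as h.
pose proof (symmetric_h_profile kappa tau a H J h) as hh.
(* The symmetry in h always holds, so only the symmetry in r is at stake; the contrapositive of this
   implication yields the last claim. *)
assert (hr : symmetric_r kappa (trace (profile kappa tau a H J)) ->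
  2 * tau ^ 2 - a * tau * kappa = 0).
{ intros hs; apply (equator_closing kappa tau a H J); auto.
  apply (equator_of_symmetric_r kappa tau a); auto. }
split; [split|].
- intros [_ hs]; auto.
- intros hz; split; auto; apply symmetric_r_of_pitch; auto.
  apply (equator_of_pitch kappa tau a); auto.
- intros hz; split; auto.
Qed.
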